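(* Let $G$ be a graph with $V(G)=\{v_1,\ldots,v_n\}$, let $t$ be a prime power, and let $\mathcal{H}=(L,H)$ be a good prime cover of $G$ of order $t$. View the graph polynomial $f_G(x_1,\ldots,x_n)=\prod_{v_iv_j\in E(G),\, j>i}(x_i-x_j)$ as an element of $\mathbb{F}_t[x_1,\ldots,x_n]$. If $t_1,\ldots,t_n$ are nonnegative integers such that the coefficient of $\prod_{i=1}^n x_i^{t_i}$ in the expansion of $f_G$ is nonzero and $|L(v_i)|>t_i$ for each $i\in[n]$, then there exists an $\mathcal{H}$-coloring of $G$.
   Context: All graphs are finite and simple. A cover of a graph $G$ is a pair $\mathcal{H}=(L,H)$ where $H$ is a graph and $L:V(G)\to\mathcal{P}(V(H))$ satisfies: (1) $\{L(u):u\in V(G)\}$ is a partition of $V(H)$; (2) each $H[L(u)]$ is complete; (3) if $E_H(L(u),L(v))\neq\emptyset$ then $u=v$ or $uv\in E(G)$; (4) if $uv\in E(G)$ then $E_H(L(u),L(v))$ is a matching (possibly empty). An $\mathcal{H}$-coloring of $G$ is an independent set in $H$ of size $|V(G)|$ (equivalently, an independent set meeting each $L(u)$ in exactly one vertex). For $f:V(G)\to\mathbb{N}$, $\mathcal{H}$ is an $f$-cover if $|L(u)|=f(u)$ for all $u$. $\mathbb{F}_t$ denotes the finite field of order $t$. A cover $\mathcal{H}$ is a prime cover of order $t$ if $t$ is a prime power and $|L(v)|\le t$ for all $v$; its vertices are named so that $L(v)\subseteq\{(v,j):j\in\mathbb{F}_t\}$. For an edge $v_iv_j$ with $j>i$,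 let $A_{v_iv_j}$ (resp. $B_{v_iv_j}$) be the set of second coordinates of vertices of $L(v_i)$ (resp. $L(v_j)$) saturated by the matching $E_H(L(v_i),L(v_j))$, and the saturation function $\sigma_{v_iv_j}:A_{v_iv_j}\to B_{v_iv_j}$ sends $q$ to the unique $r$ with $(v_i,q)(v_j,r)\in E(H)$. It is good if there is $\beta\in\mathbb{F}_t$ with $a-\sigma_{v_iv_j}(a)=\beta$ for all $a\in A_{v_iv_j}$ (subtraction in $\mathbb{F}_t$; it is good if $A_{v_iv_j}=\emptyset$), and bad otherwise. A prime cover of order $t$ is good if there exists a naming of the vertices of $H$ with $L(v)\subseteq\{(v,j):j\in\mathbb{F}_t\}$ for which every saturation function (for every edge $v_iv_j$, $j>i$) is good. *)

(* Defs.v *)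
From HB Require Import structures.
From mathcomp Require Import all_boot all_order all_algebra.
From mathcomp Require Import mpoly.

Set Implicit Arguments.
Unset Strict Implicit.
Unset Printing Implicit Defensive.

Import GRing.Theory.
Local Open Scope ring_scope.

Record sgraph := SGraph {
  vertex :> finType;
  adj : rel vertex;
  adj_sym : ssrbool.symmetric adj;
  adj_irr : irreflexive adj
}.

Definition independent (H : sgraph) (S : {set H}) : Prop :=
  {in S &, forall x y, ~~ adj x y}.

Definition clique (H : sgraph) (S : {set H}) : Prop :=
  {in S &, forall x y, x != y -> adj x y}.

(* E_H(A, B); an edge is the set of its two endpoints. *)
Definition edges_between (H : sgraph) (A B : {set H}) : {set {set H}} :=
  [set [set x; y] | x in A, y in B & adj x y].

Definition matching (H : sgraph) (M : {set {set H}}) : Prop := trivIset M.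

(* finset's cover M is the union of the edges of M. *)
Definition saturated (H : sgraph) (M : {set {set H}}) (x : H) : bool :=
  x \in cover M.

(* finset's partition sees only the set of the L u; injectivity of L says that
   distinct vertices of G get distinct blocks. *)
Record is_cover (G H : sgraph) (L : G -> {set H}) : Prop := IsCover {
  cover_inj : injective L;
  cover_partition : partition [set L u | u : G] [set: H];
  cover_clique : forall u, clique (L u);
  cover_edges : forall u v,
    edges_between (L u) (L v) != set0 -> u = v \/ adj u v;
  cover_matching : forall u v,
    adj u v -> matching (edges_between (L u) (L v))
}.

Definition is_coloring (G H : sgraph) (S : {set H}) : Prop :=
  independent S /\ #|S| = #|G|.

Definition prime_power (t : nat) : Prop :=
  exists p k : nat, [/\ prime p, (0 < k)%N & t = (p ^ k)%N].

Definition prime_cover (G H : sgraph) (L : G -> {set H}) (t : nat) : Prop :=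
  [/\ is_cover L, prime_power t & forall v, (#|L v| <= t)%N].

(* The name of x : H is nu x; the vertices of L u are named (u, j), j in F. *)
Definition naming (F : finFieldType) (G H : sgraph) (L : G -> {set H})
    (nu : H -> G * F) : Prop :=
  injective nu /\ forall u x, x \in L u -> (nu x).1 = u.

(* A_{uw}, for an edge uw of G. *)
Definition sat_dom (F : finFieldType) (G H : sgraph) (L : G -> {set H})
    (nu : H -> G * F) (u w : G) : {set F} :=
  [set (nu x).2 | x in L u & saturated (edges_between (L u) (L w)) x].

(* sigma_{uw}; only meaningful on sat_dom L nu u w, where the r picked exists
   and, for a naming of a cover, is unique. The value 0 elsewhere is junk. *)
Definition sat_fun (F : finFieldType) (G H : sgraph) (nu : H -> G * F)
    (u w : G) (q : F) : F :=
  odflt 0 [pick r | [exists x, exists y,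
    [&& nu x == (u, q), nu y == (w, r) & adj x y]]].

Definition good_sat_fun (F : finFieldType) (G H : sgraph) (L : G -> {set H})
    (nu : H -> G * F) (u w : G) : Prop :=
  exists beta : F,
    forall a, a \in sat_dom L nu u w -> a - sat_fun nu u w a = beta.

(* v enumerates V(G) as v_1, ..., v_n, and F is the field of order t. *)
Definition good_prime_cover (F : finFieldType) (G H : sgraph)
    (L : G -> {set H}) (t n : nat) (v : 'I_n -> G) : Prop :=
  prime_cover L t /\
  exists nu : H -> G * F, naming L nu /\
    forall i j : 'I_n, (i < j)%N -> adj (v i) (v j) ->
      good_sat_fun L nu (v i) (v j).

Definition graph_poly (F : finFieldType) (G : sgraph) (n : nat)
    (v : 'I_n -> G) : {mpoly F[n]} :=
  \prod_(p : 'I_n * 'I_n | (p.1 < p.2)%N && adj (v p.1) (v p.2))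
    ('X_(p.1) - 'X_(p.2)).

(* Main.v *)
Require Import Defs.
From HB Require Import structures.
From mathcomp Require Import all_boot all_order all_algebra.
From mathcomp Require Import mpoly.

Set Implicit Arguments.
Unset Strict Implicit.
Unset Printing Implicit Defensive.

Import GRing.Theory.
Local Open Scope ring_scope.

(** Give the vertices of [L (v i)] their names in [F]. If every saturation
    function is a translation by some [beta i j], then a choice [a i] of one name
    in each [L (v i)] is a colouring as soon as the product of the factors
    [x_i - x_j - beta i j] over the edges does not vanish at [a]. The top degree
    part of this product is the graph polynomial, so that the Combinatorial
    Nullstellensatz provides [a]. The latter is proved by the coefficient
    formula: weights on the points of each grid side [A i], obtained by inverting
    a Vandermonde matrix, kill the powers [x ^ e] with [e < d i] and send
    [x ^ d i] to 1; the weighted sum of [p] over the grid is then the coefficient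
    of [x ^ d] in [p]. *)

(** The first [d.+1] points are distinct, so their Vandermonde matrix is invertible; the other
    points get weight 0. This vanishing beyond [d] later ensures that a grid index of nonzero weight
    is a genuine index of its side. *)
Lemma top_power_weights (F : fieldType) (s : seq F) (d : nat) :
  uniq s -> (d < size s)%N ->
  exists w : nat -> F, (forall k, (d < k)%N -> w k = 0) /\
    forall e, (e <= d)%N ->
      \sum_(k < size s) w k * s`_k ^+ e = (e == d)%:R.
Proof.
move=> uniq_s lt_ds.
pose V := Vandermonde d.+1 (\row_(k < d.+1) s`_k).
have unitV : V \in unitmx.
  rewrite unitmxE det_Vandermonde unitfE; apply/prodf_neq0 => i _.
  apply/prodf_neq0 => j lt_ij; rewrite !mxE subr_eq0 nth_uniq //.
  - by rewrite neq_ltn lt_ij orbT.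
  - exact: leq_trans (ltn_ord j) lt_ds.
  - exact: leq_trans (ltn_ord i) lt_ds.
(* [c] is the last column of the inverse of [V]: row [e] of [V *m c] is the weighted sum of the
   [e]-th powers. *)
pose c := invmx V *m delta_mx ord_max (0 : 'I_1).
exists (fun k => if (k < d.+1)%N then c (inord k) 0 else 0).
split=> [k lt_dk|e le_ed]; first by rewrite ltnNge lt_dk.
transitivity (\sum_(k < d.+1) c k 0 * s`_k ^+ e).
  rewrite (eq_bigr (fun k : 'I_d.+1 => c (inord k) 0 * s`_k ^+ e)); last first.
    by move=> k _; rewrite inord_val.
  rewrite (big_ord_widen _ (fun k => c (inord k) 0 * s`_k ^+ e) lt_ds).
  rewrite [RHS]big_mkcond; apply: eq_bigr => k _.
  by case: ifP; rewrite ?mul0r.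
have /matrixP/(_ (inord e) 0) := mulKVmx unitV (delta_mx ord_max (0 : 'I_1)).
rewrite !mxE andbT -val_eqE /= inordK // => <-.
by apply: eq_bigr => k _; rewrite !mxE inordK // mulrC.
Qed.

Lemma combinatorial_nullstellensatz (F : fieldType) (n : nat)
    (p : {mpoly F[n]}) (d : 'X_{1..n}) (A : 'I_n -> seq F) :
    (msize p <= (mdeg d).+1)%N -> p@_d != 0 ->
    (forall i, uniq (A i)) -> (forall i, (d i < size (A i))%N) ->
  exists a : 'I_n -> F, (forall i, a i \in A i) /\ p.@[a] != 0.
Proof.
move=> le_pd p_d uniqA lt_dA.
have /fin_all_exists[w wP] i := top_power_weights (uniqA i) (lt_dA i).
(* [N] bounds all the sizes, so that one finite type indexes every side. *)
pose N := (\sum_i size (A i))%N.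
have le_AN i : (size (A i) <= N)%N by rewrite /N (bigD1 i) //= leq_addr.
have wN i e : (e <= d i)%N ->
    \sum_(k < N) w i k * (A i)`_k ^+ e = (e == d i)%:R.
  move=> le_ed; rewrite -(wP i).2 //.
  rewrite (big_ord_widen _ (fun k => w i k * (A i)`_k ^+ e) (le_AN i)).
  rewrite [RHS]big_mkcond; apply: eq_bigr => k _; case: ifP => // /negbT.
  by rewrite -leqNgt => le_Ak; rewrite (wP i).1 ?mul0r // (leq_trans (lt_dA i)).
pose pt (k : {ffun 'I_n -> 'I_N}) i := (A i)`_(k i).
have coefE : p@_d =
    \sum_(k : {ffun 'I_n -> 'I_N}) (\prod_i w i (k i)) * p.@[pt k].
  under eq_bigr do rewrite mevalE mulr_sumr.
  rewrite exchange_big /=.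
  transitivity (\sum_(m <- msupp p) p@_m * (m == d)%:R).
    have p_supp : d \in msupp p by rewrite mcoeff_msupp.
    rewrite (bigD1_seq d) ?msupp_uniq //= eqxx mulr1 big1 ?addr0 // => m.
    by move=> /negPf->; rewrite mulr0.
  rewrite big_seq [RHS]big_seq; apply: eq_bigr => m m_p.
  transitivity (p@_m * \prod_i \sum_(k < N) w i k * (A i)`_k ^+ m i).
    congr (_ * _); have [->|neq_md] := eqVneq m d.
      by rewrite big1 // => i _; rewrite wN // eqxx.
    (* Without such an [i], [d] would divide [m], and the degree bound would force [m = d]. One such
       coordinate kills the whole product, whatever the other exponents. *)
    suff [i lt_i] : exists i, (m i < d i)%N.
      by rewrite (bigD1 i) //= wN ?(ltnW lt_i) // ltn_eqF // mul0r.
    apply/existsP; apply: contraNT neq_md; rewrite negb_exists => /forallP le_dm.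
    have {}le_dm i : (d i <= m i)%N by rewrite leqNgt.
    have : (mdeg m <= mdeg d)%N by apply: leq_trans (msize_mdeg_lt m_p) le_pd.
    have /mnm_lepP le_dm' := le_dm; rewrite -(submK le_dm') mdegD.
    rewrite -{2}[mdeg d]add0n leq_add2r leqn0 mdeg_eq0 => /eqP->.
    by rewrite add0m.
  rewrite bigA_distr_bigA mulr_sumr; apply: eq_bigr => k _.
  by rewrite big_split /= mulrCA.
have [k k_neq0] : exists k : {ffun 'I_n -> 'I_N},
    (\prod_i w i (k i)) * p.@[pt k] != 0.
  apply/existsP; apply: contraNT p_d; rewrite negb_exists => /forallP k0.
  by rewrite coefE big1 // => k _; apply/eqP; rewrite -[_ == _]negbK.
exists (pt k); move: k_neq0; rewrite mulf_eq0 negb_or => /andP[/prodf_neq0 w_k ->].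
(* Nonzero weights force [k i <= d i], so that [pt k i] is a point of [A i] and not the default
   value of the sequence. *)
split=> // i; apply: mem_nth; apply: leq_ltn_trans (lt_dA i).
by rewrite leqNgt; apply: contraNN (w_k i isT) => /(wP i).1->.
Qed.

Lemma msize_dhomog (R : nzRingType) (n e : nat) (p : {mpoly R[n]}) :
  p \is e.-homog -> (msize p <= e.+1)%N.
Proof.
move=> /dhomogP p_e; rewrite msizeE; apply/bigmax_leqP_seq => m m_p _.
by rewrite -(p_e m m_p).
Qed.

Lemma msizeM_leq (R : idomainType) (n : nat) (p q : {mpoly R[n]}) :
  (msize (p * q) <= (msize p + msize q).-1)%N.
Proof.
have [->|p0] := eqVneq p 0; first by rewrite mul0r msize0.
have [->|q0] := eqVneq q 0; first by rewrite mulr0 msize0.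
by rewrite msizeM.
Qed.

Lemma dhomog_prod_linear (R : comNzRingType) (n : nat) (I : Type) (s : seq I)
    (l : I -> {mpoly R[n]}) :
  (forall i, l i \is 1.-homog) -> \prod_(i <- s) l i \is (size s).-homog.
Proof.
move=> l1; elim: s => [|i s IHs]; first by rewrite big_nil dhomog1.
by rewrite big_cons /= -add1n; apply: dhomogM.
Qed.

(** As [msize] is the degree plus one, the bound says that constant shifts of the factors leave the
    part of degree [size s] unchanged. *)
Lemma msize_prod_linear_shift (R : idomainType) (n : nat) (I : Type) (s : seq I)
    (l : I -> {mpoly R[n]}) (c : I -> R) :
  (forall i, l i \is 1.-homog) ->
  (msize (\prod_(i <- s) (l i - (c i)%:MP) - \prod_(i <- s) l i) <= size s)%N.
Proof.
move=> l1; elim: s => [|i s IHs]; first by rewrite !big_nil subrr msize0.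
rewrite !big_cons /=; have := msize_dhomog (dhomog_prod_linear s l1).
move: IHs; set Q := \prod_(j <- s) l j; set Q' := \prod_(j <- s) _ => IHs leQ.
(* The induction hypothesis bounds [Q' - Q], and the only other term, a multiple of [Q], lacks the
   factor [l i]. *)
have -> : (l i - (c i)%:MP) * Q' - l i * Q =
          l i * (Q' - Q) + (- c i) *: (Q + (Q' - Q)).
  by rewrite [Q + _]addrC subrK scaleNr -mul_mpolyC mulrBl mulrBr addrAC.
apply: leq_trans (mmeasureD_le _ _ _) _; rewrite geq_max; apply/andP; split.
  apply: leq_trans (msizeM_leq _ _) _.
  rewrite -ltnS; have := leq_add (msize_dhomog (l1 i)) IHs.
  by case: (_ + _)%N => //= k; rewrite add2n ltnS.
apply: leq_trans (msizeZ_le _ _) _; apply: leq_trans (mmeasureD_le _ _ _) _.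
by rewrite geq_max leQ (leq_trans IHs).
Qed.

Section GoodCover.

Variables (F : finFieldType) (G H : sgraph) (L : G -> {set H}).
Variable nu : H -> G * F.
Hypotheses (coverL : is_cover L) (nuL : naming L nu).

(** A naming constrains only vertices already known to lie in some [L u]; the blocks cover [H],
    which gives the converse. *)
Lemma naming_mem x : x \in L (nu x).1.
Proof.
have : x \in cover [set L u | u : G].
  by rewrite (cover_partition (Defs.cover_partition coverL)) inE.
by move=> /bigcupP[B /imsetP[u _ ->]] xu; rewrite (nuL.2 u).
Qed.

Lemma card_names u : #|[set (nu x).2 | x in L u]| = #|L u|.
Proof.
apply: card_in_imset => x y xu yu eq_xy; apply: nuL.1.
by apply: injective_projections => //; rewrite !(nuL.2 u).
Qed.

Lemma mem_edges_between u w x y :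
  x \in L u -> y \in L w -> adj x y ->
  [set x; y] \in edges_between (L u) (L w).
Proof. by move=> xu yw xy; apply/imset2P; exists x y => //; rewrite inE yw. Qed.

(** An edge of [H] makes the [pick] succeed, and the matching leaves only one possible value. *)
Lemma sat_fun_adj u w x y : adj u w ->
  x \in L u -> y \in L w -> adj x y ->
  (nu x).2 \in sat_dom L nu u w /\ sat_fun nu u w (nu x).2 = (nu y).2.
Proof.
move=> uw xu yw xy; have xyE := mem_edges_between xu yw xy.
split.
  apply/imsetP; exists x => //; rewrite inE xu /=.
  by apply/bigcupP; exists [set x; y]; rewrite // set21.
have nuE z a : z \in L a -> nu z = (a, (nu z).2).
  by move=> za; rewrite -(nuL.2 _ _ za) -surjective_pairing.
rewrite /sat_fun; case: pickP => [r|/(_ (nu y).2)]; last first.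
  move/existsP; case; exists x; apply/existsP; exists y.
  by rewrite -!nuE // !eqxx.
move=> /existsP[x' /existsP[z /and3P[/eqP nux' /eqP nuz x'z]]] /=.
have eq_x' : x' = x by apply: nuL.1; rewrite nux' -nuE.
move: x'z; rewrite eq_x' => xz.
have zw : z \in L w by have := naming_mem z; rewrite nuz.
have xzE := mem_edges_between xu zw xz.
have /trivIsetP triv := cover_matching coverL uw.
(* Distinct edges of a matching are disjoint, but these two share [x]. *)
have eqE : [set x; y] = [set x; z].
  apply/eqP; apply: contraT => /(triv _ _ xyE xzE).
  by move/disjoint_setI0/setP/(_ x); rewrite !inE eqxx.
have : z \in [set x; y] by rewrite eqE set22.
rewrite !inE => /orP[/eqP eq_zx|/eqP <-]; last by rewrite nuz.
by move: xz; rewrite eq_zx adj_irr.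
Qed.

End GoodCover.

Theorem theorem1p3 (G : sgraph) (n : nat) (v : 'I_n -> G) (v_bij : bijective v)
    (t : nat) (t_pp : prime_power t) (F : finFieldType) (cardF : #|F| = t)
    (H : sgraph) (L : G -> {set H}) (goodL : good_prime_cover F L t v)
    (d : 'I_n -> nat)
    (coef_neq0 : (graph_poly F v)@_[multinom d i | i < n] != 0)
    (d_lt : forall i : 'I_n, (d i < #|L (v i)|)%N) :
  exists S : {set H}, is_coloring G S.
Proof.
case: goodL => [[coverL _ _] [nu [nuL good_nu]]].
pose edge (e : 'I_n * 'I_n) := (e.1 < e.2)%N && adj (v e.1) (v e.2).
have /fin_all_exists[beta betaP] (e : 'I_n * 'I_n) : exists b : F,
    edge e -> forall a, a \in sat_dom L nu (v e.1) (v e.2) ->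
      a - sat_fun nu (v e.1) (v e.2) a = b.
  have [/andP[lt_e adj_e]|] := boolP (edge e); last by exists 0.
  by have [b bP] := good_nu _ _ lt_e adj_e; exists b.
pose es := [seq e <- index_enum _ | edge e].
pose l (e : 'I_n * 'I_n) : {mpoly F[n]} := 'X_(e.1) - 'X_(e.2).
pose q := \prod_(e <- es) (l e - (beta e)%:MP).
have l1 e : l e \is 1.-homog.
  by apply: rpredB; rewrite dhomogX /= mdeg1.
have gE : graph_poly F v = \prod_(e <- es) l e by rewrite /es big_filter.
set m := [multinom d i | i < n] in coef_neq0.
have g_homog := dhomog_prod_linear es l1; rewrite -gE in g_homog.
(* The graph polynomial is homogeneous, so a monomial with nonzero coefficient has degree the number
   of edges. *)
have mE : mdeg m = size es.
  by apply: (dhomog_mf g_homog); rewrite mcoeff_msupp.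
have le_shift := msize_prod_linear_shift es beta l1.
rewrite -gE -/q in le_shift.
(* The shifts only affect degrees below [mdeg m], hence not this coefficient. *)
have q_m : q@_m != 0.
  rewrite -[q](subrK (graph_poly F v)) mcoeffD memN_msupp_eq0 ?add0r //.
  by apply: msize_mdeg_ge; rewrite mE.
have le_q : (msize q <= (mdeg m).+1)%N.
  rewrite -[q](subrK (graph_poly F v)) mE; apply: leq_trans (mmeasureD_le _ _ _) _.
  by rewrite geq_max (leq_trans le_shift) // msize_dhomog.
pose A i := enum [set (nu x).2 | x in L (v i)].
have [||a [aA q_a]] := combinatorial_nullstellensatz (A := A) le_q q_m.
- by move=> i; apply: enum_uniq.
- by move=> i; rewrite mnmE -cardE (card_names nuL).
have /fin_all_exists[x xP] i : exists x, x \in L (v i) /\ a i = (nu x).2.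
  by have := aA i; rewrite mem_enum => /imsetP[x xL ->]; exists x.
have x_inj : injective x.
  move=> i j eq_x; apply: (bij_inj v_bij).
  by rewrite -(nuL.2 _ _ (xP i).1) eq_x (nuL.2 _ _ (xP j).1).
have x_nadj (i j : 'I_n) : (i < j)%N -> ~~ adj (x i) (x j).
  move=> lt_ij; apply/negP => xij.
  have vij : adj (v i) (v j).
    case: (cover_edges coverL (u := v i) (v := v j)) => //.
      apply/set0Pn; exists [set x i; x j].
      by apply: mem_edges_between => //; apply: (xP _).1.
    by move/(bij_inj v_bij) => eq_ij; rewrite eq_ij ltnn in lt_ij.
  have [dom_i sat_i] := sat_fun_adj coverL nuL vij (xP i).1 (xP j).1 xij.
  (* Adjacency would give [a i - a j = beta (i, j)], so a factor of [q] would vanish at [a]. *)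
  have edge_ij : edge (i, j) by rewrite /edge lt_ij.
  have := betaP _ edge_ij _ dom_i; rewrite /= sat_i -(xP i).2 -(xP j).2 => eq_b.
  move: q_a; rewrite rmorph_prod /= big_filter => /prodf_neq0/(_ _ edge_ij).
  by rewrite !mevalB !mevalXU mevalC /= eq_b subrr eqxx.
exists [set x i | i : 'I_n]; split; last first.
  by rewrite card_imset // -(bij_eq_card v_bij) card_ord.
move=> _ _ /imsetP[i _ ->] /imsetP[j _ ->].
case: (ltngtP i j) => [lt_ij|lt_ji|/ord_inj ->]; first exact: x_nadj.
  by rewrite adj_sym x_nadj.
by rewrite adj_irr.
Qed.
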